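(* Let $n\ge0$ and $k\ge1$ be fixed integers and $\eta>0$ a fixed constant. Let $\delta_0>0$ be such that (A1) $\boldsymbol f$ is twice continuously differentiable on $B(\boldsymbol s,\delta_0)$ and (A2) $\|\tilde{\boldsymbol F}\|\le\max_{\boldsymbol x\in B(\boldsymbol s,\delta_0)}\|\boldsymbol F(\boldsymbol x)\|=L<1$. Then there exists $\delta\in(0,\delta_0]$ such that the following holds. Suppose RRE is applied in the C-Mode, with these $n$ and $k$ and without stopping, starting from (A3) a vector $\boldsymbol s^{(0)}_{n,k}:=\boldsymbol x_0\in B(\boldsymbol s,\delta)$; suppose that in every cycle $r\ge1$ the vector $\boldsymbol\epsilon_n^{(r)}$ is nonzero and $k$ is less than the degree of the minimal polynomial of $\tilde{\boldsymbol F}$ with respect to $\boldsymbol\epsilon^{(r)}_n$; and suppose that (A4) $\|(\tilde{\boldsymbol W}^{(r)})^{+}\|_2\le\eta/\|\boldsymbol\epsilon_n^{(r)}\|$ in every cycle $r\ge1$. Then $\lim_{r\to\infty}\boldsymbol s^{(r)}_{n,k}=\boldsymbol s$, and the convergence is linear in the sense that $$\limsup_{r\to\infty}\frac{\|\boldsymbol s^{(r+1)}_{n,k}-\boldsymbol s\|}{\|\boldsymbol s^{(r)}_{n,k}-\boldsymbol s\|}\le\theta_kL^n<1 .$$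
   Context: Setting: $\boldsymbol f:\mathbb C^N\to\mathbb C^N$, $\boldsymbol s$ is a solution of $\boldsymbol x=\boldsymbol f(\boldsymbol x)$, $\boldsymbol F(\boldsymbol x)$ is the Jacobian matrix of $\boldsymbol f$ at $\boldsymbol x$, $\tilde{\boldsymbol F}=\boldsymbol F(\boldsymbol s)$ with $\rho(\tilde{\boldsymbol F})<1$, and $\boldsymbol G=\boldsymbol I-\tilde{\boldsymbol F}$ (nonsingular). $\|\cdot\|_2$ is the standard $l_2$ vector norm and its induced matrix norm. $\|\boldsymbol z\|=\|\boldsymbol G\boldsymbol z\|_2$ for $\boldsymbol z\in\mathbb C^N$, and for $N\times N$ matrices $\|\boldsymbol A\|=\|\boldsymbol G\boldsymbol A\boldsymbol G^{-1}\|_2$ is the induced norm. $B(\boldsymbol s,\delta)=\{\boldsymbol x:\|\boldsymbol x-\boldsymbol s\|\le\delta\}$. Reduced Rank Extrapolation (RRE): given $\boldsymbol x_0$ and $\boldsymbol x_{m+1}=\boldsymbol f(\boldsymbol x_m)$, with $\boldsymbol u_m=\boldsymbol x_{m+1}-\boldsymbol x_m$, $\boldsymbol w_m=\boldsymbol u_{m+1}-\boldsymbol u_m$, and the $N\times k$ matrices $\boldsymbol U=[\boldsymbol u_n|\cdots|\boldsymbol u_{n+k-1}]$, $\boldsymbol W=[\boldsymbol w_n|\cdots|\boldsymbol w_{n+k-1}]$, the RRE approximation is $\boldsymbol s_{n,k}=\boldsymbol x_n-\boldsymbol U\boldsymbol W^{+}\boldsymbol u_n$, where $^{+}$ is the Moore–Penrose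 inverse. (Equivalently $\boldsymbol s_{n,k}=\sum_{i=0}^k\gamma_i\boldsymbol x_{n+i}$ with the $\gamma_i$ minimizing $\|\sum_{i=0}^k\gamma_i\boldsymbol u_{n+i}\|_2$ subject to $\sum_{i=0}^k\gamma_i=1$.) C-Mode (cycling with fixed $n,k$): set $\boldsymbol s^{(0)}_{n,k}=\boldsymbol x_0$. In cycle $r=1,2,\ldots$, put $\boldsymbol x_0^{(r)}=\boldsymbol s^{(r-1)}_{n,k}$, compute $\boldsymbol x^{(r)}_{m+1}=\boldsymbol f(\boldsymbol x^{(r)}_m)$ for $m=0,\ldots,n+k$, and let $\boldsymbol s^{(r)}_{n,k}$ be the RRE approximation $\boldsymbol s_{n,k}$ computed from $\boldsymbol x^{(r)}_n,\ldots,\boldsymbol x^{(r)}_{n+k+1}$. Put $\boldsymbol\epsilon^{(r)}_m=\boldsymbol x^{(r)}_m-\boldsymbol s$. The matrix $\tilde{\boldsymbol W}^{(r)}$ is the $N\times k$ matrix with columns $(\tilde{\boldsymbol F}-\boldsymbol I)^2\tilde{\boldsymbol F}^{\,i}\boldsymbol\epsilon^{(r)}_n$, $i=0,\ldots,k-1$. The minimal polynomial of $\boldsymbol T$ with respect to a nonzero vector $\boldsymbol u$ is the monic polynomial $P$ of smallest degree with $P(\boldsymbol T)\boldsymbol u=\boldsymbol 0$. $\theta_k=\min_{g\in\tilde{\mathcal P}_k}\|g(\tilde{\boldsymbol F})\|_2$, where $\tilde{\mathcal P}_k=\{g(z)=\sum_{j=0}^k\alpha_jz^j:\ g(1)=1\}$.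 *)

(* Defs.v *)
From HB Require Import structures.
From mathcomp Require Import all_boot all_order all_algebra.
From mathcomp Require Import complex.
From mathcomp Require Import all_classical all_reals all_analysis.

Set Implicit Arguments.
Unset Strict Implicit.
Unset Printing Implicit Defensive.

Import Order.TTheory GRing.Theory Num.Theory.
Import numFieldNormedType.Exports.

Local Open Scope classical_set_scope.
Local Open Scope sesquilinear_scope.
Local Open Scope ring_scope.
Local Open Scope complex_scope.

(* R[i] as a normed module over itself; this also gives the topology of
   complex vectors and matrices. *)
HB.instance Definition _ (R : realType) :=
  NormedModule.copy (complex R) (complex R)^o.

Definition l2norm (R : realType) (N : nat) (v : 'cV[R[i]]_N) : R :=
  Num.sqrt (\sum_i Normc.normc (v i 0) ^+ 2).

Definition l2opnorm (R : realType) (M N : nat) (A : 'M[R[i]]_(M, N)) : R :=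
  sup [set l2norm (A *m z) | z in [set z | l2norm z = 1]].

Definition wnorm (R : realType) (N : nat) (G : 'M[R[i]]_N)
  (z : 'cV[R[i]]_N) : R := l2norm (G *m z).

Definition wopnorm (R : realType) (N : nat) (G A : 'M[R[i]]_N) : R :=
  l2opnorm (G *m A *m invmx G).

Definition wball (R : realType) (N : nat) (G : 'M[R[i]]_N)
  (s : 'cV[R[i]]_N) (d : R) : set 'cV[R[i]]_N :=
  [set x | wnorm G (x - s) <= d].

Definition spectral_radius (R : realType) (N : nat) (A : 'M[R[i]]_N) : R :=
  sup [set Normc.normc a | a in [set a | eigenvalue A a]].

(* The (i, j) entry is the complex partial derivative of the i-th component of f
   with respect to the j-th coordinate.  The library's jacobian is the transpose:
   it is for row vectors, with linear maps acting on the right. *)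
Definition jacobian_mx (R : realType) (N : nat)
  (f : 'cV[R[i]]_N -> 'cV[R[i]]_N) (x : 'cV[R[i]]_N) : 'M[R[i]]_N :=
  \matrix_(i, j) ('D_(delta_mx j 0) f x) i 0.

(* Derivatives at points of B are taken in the whole space, and the second
   derivative is continuous for the subspace topology of B.  This holds in
   particular if f is twice continuously differentiable on an open set
   containing B. *)
Definition C2_on (R : realType) (N : nat) (B : set 'cV[R[i]]_N)
  (f : 'cV[R[i]]_N -> 'cV[R[i]]_N) : Prop :=
  [/\ forall x, B x -> differentiable f x,
      forall x, B x -> differentiable (jacobian_mx f) x
    & forall v : 'cV[R[i]]_N,
        {within B, continuous (fun x => 'D_v (jacobian_mx f) x)}].

Definition penrose (R : realType) (M N : nat) (A : 'M[R[i]]_(M, N))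
  (X : 'M[R[i]]_(N, M)) : Prop :=
  [/\ A *m X *m A = A, X *m A *m X = X,
      (A *m X)^t* = A *m X & (X *m A)^t* = X *m A].

Definition mp_inverse (R : realType) (M N : nat) (A : 'M[R[i]]_(M, N)) :
  'M[R[i]]_(N, M) := xget 0 [set X | penrose A X].

Lemma trmxC_mul (R : realType) (M N P : nat) (A : 'M[R[i]]_(M, N))
  (B : 'M[R[i]]_(N, P)) : (A *m B)^t* = B^t* *m A^t*.
Proof. by rewrite trmx_mul map_mxM. Qed.

Lemma penrose_unique (R : realType) (M N : nat) (A : 'M[R[i]]_(M, N))
  (X Y : 'M[R[i]]_(N, M)) : penrose A X -> penrose A Y -> X = Y.
Proof.
move=> [AXA XAX AXh XAh] [AYA YAY AYh YAh].
have E1 : A *m X = A *m Y.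
  by rewrite -AXh -[in LHS]AYA -mulmxA trmxC_mul AXh AYh mulmxA AXA.
have E2 : X *m A = Y *m A.
  rewrite -XAh -[in LHS]AYA -[A *m Y *m A]mulmxA mulmxA trmxC_mul XAh YAh.
  by rewrite -mulmxA (mulmxA A) AXA.
by rewrite -XAX E2 -mulmxA E1 mulmxA.
Qed.

Lemma gram_unit (R : realType) (M N : nat) (A : 'M[R[i]]_(M, N)) :
  row_free A -> A *m A^t* \in unitmx.
Proof.
move=> /row_freeP[B AB]; rewrite -row_free_unit -kermx_eq0.
apply/rowV0P => v /sub_kermxP; rewrite mulmxA => vAA.
have /eqP : dotmx (v *m A) (v *m A) = 0.
  by rewrite dotmxE trmxC_mul mulmxA vAA mul0mx mxE.
rewrite dnorm_eq0 => /eqP vA.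
by rewrite -[v]mulmx1 -AB mulmxA vA mul0mx.
Qed.

Lemma penrose_exists (R : realType) (M N : nat) (A : 'M[R[i]]_(M, N)) :
  exists X, penrose A X.
Proof.
have [r [B [C [-> Bu Cu]]]] : exists r, exists B : 'M[R[i]]_(M, r),
    exists C : 'M[R[i]]_(r, N),
    [/\ A = B *m C, B^t* *m B \in unitmx & C *m C^t* \in unitmx].
  exists (\rank A), (col_base A), (row_base A); split; first by rewrite mulmx_base.
    rewrite -[X in _ *m X]trmxCK; apply: gram_unit.
    by rewrite row_free_map /row_free mxrank_tr -/(row_full _) col_base_full.
  exact/gram_unit/row_base_free.
set P := invmx (B^t* *m B); set Q := invmx (C *m C^t*).
have PK : P *m (B^t* *m B) = 1%:M by rewrite mulVmx.
have KQ : C *m C^t* *m Q = 1%:M by rewrite mulmxV.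
have Ph : P^t* = P.
  by rewrite /P trmx_inv map_invmx trmxC_mul trmxCK.
have Qh : Q^t* = Q.
  by rewrite /Q trmx_inv map_invmx trmxC_mul trmxCK.
have AX : B *m C *m (C^t* *m Q *m P *m B^t*) = B *m P *m B^t*.
  by rewrite -!mulmxA (mulmxA C) (mulmxA _ Q) KQ mul1mx.
have XA : C^t* *m Q *m P *m B^t* *m (B *m C) = C^t* *m Q *m C.
  by rewrite -!mulmxA (mulmxA (B^t*)) (mulmxA P) PK mul1mx.
exists (C^t* *m Q *m P *m B^t*); split.
- by rewrite AX -!mulmxA (mulmxA (B^t*)) (mulmxA P) PK mul1mx.
- by rewrite XA -!mulmxA (mulmxA C) (mulmxA (C *m _)) KQ mul1mx.
- by rewrite AX !trmxC_mul trmxCK Ph mulmxA.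
- by rewrite XA !trmxC_mul trmxCK Qh mulmxA.
Qed.

Lemma mp_inverseP (R : realType) (M N : nat) (A : 'M[R[i]]_(M, N)) :
  penrose A (mp_inverse A).
Proof.
rewrite /mp_inverse; case: xgetP => [X _ //|noX].
by have [X AX] := penrose_exists A; case: (noX X).
Qed.

Definition minpoly_wrt (R : realType) (N : nat) (T : 'M[R[i]]_N.+1)
  (u : 'cV[R[i]]_N.+1) (P : {poly R[i]}) : Prop :=
  [/\ P \is monic, horner_mx T P *m u = 0
    & forall Q : {poly R[i]}, Q \is monic -> horner_mx T Q *m u = 0 ->
        (size P <= size Q)%N].

(* The infimum is attained: it is the distance from 0 to a finite-dimensional
   affine subspace of matrices. *)
Definition theta (R : realType) (N : nat) (T : 'M[R[i]]_N.+1) (k : nat) : R :=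
  inf [set l2opnorm (horner_mx T g) |
        g in [set g : {poly R[i]} | (size g <= k.+1)%N /\ g.[1] = 1]].

Definition seq_diff (R : realType) (N : nat) (x : nat -> 'cV[R[i]]_N)
  (m : nat) : 'cV[R[i]]_N := x m.+1 - x m.

(* The matrix with columns v_n, ..., v_(n+k-1). *)
Definition seq_mx (R : realType) (N : nat) (v : nat -> 'cV[R[i]]_N)
  (n k : nat) : 'M[R[i]]_(N, k) := \matrix_(i, j) v (n + j)%N i 0.

Definition rre (R : realType) (N : nat) (x : nat -> 'cV[R[i]]_N)
  (n k : nat) : 'cV[R[i]]_N :=
  let u := seq_diff x in
  let w := seq_diff u in
  x n - seq_mx u n k *m mp_inverse (seq_mx w n k) *m u n.

(* The r-th cycle, r >= 1, runs the fixed-point iteration from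
   cmode f n k x0 r.-1. *)
Fixpoint cmode (R : realType) (N : nat) (f : 'cV[R[i]]_N -> 'cV[R[i]]_N)
  (n k : nat) (x0 : 'cV[R[i]]_N) (r : nat) : 'cV[R[i]]_N :=
  if r is r'.+1 then rre (fun m => iter m f (cmode f n k x0 r')) n k else x0.

Definition cycle_iterate (R : realType) (N : nat)
  (f : 'cV[R[i]]_N -> 'cV[R[i]]_N) (n k : nat) (x0 : 'cV[R[i]]_N)
  (r m : nat) : 'cV[R[i]]_N := iter m f (cmode f n k x0 r.-1).

(* For T = F(s) and e = epsilon_n^(r), this is the matrix W tilde of cycle r. *)
Definition Wtilde (R : realType) (N : nat) (T : 'M[R[i]]_N.+1)
  (e : 'cV[R[i]]_N.+1) (k : nat) : 'M[R[i]]_(N.+1, k) :=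
  seq_mx (fun j => (T - 1) ^+ 2 *m T ^+ j *m e) 0 k.

(* Main.v *)
(* Let e = x_n - s and G = I - F(s).  Differentiability of f at s gives
   x_(n+j) - s = F(s)^j e + o(|e|), hence u_n = - G e + o(|e|) and
   W = - G U + o(|e|) = Wtilde + o(|e|).  The bound on the pseudo-inverse of
   Wtilde, which has full column rank, bounds that of W by O(1/|e|).  Therefore
   G (s_(n,k) - s) = - (I - W W^+) u_n + o(|e|), and W W^+ is the orthogonal
   projector on the range of W, so that the first term is at most
   |u_n + W z|_2 for every fixed z.  If g = 1 + (X - 1) h with h of size at
   most k, taking for z the coefficients of h makes this
   |g(F(s)) G e|_2 + o(|e|).  Finally |e| <= (L^n + o(1)) |x_0 - s|, and g is
   arbitrary.  The choice g = X shows that the iteration is a contraction near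
   s. *)
Require Import Defs.
From HB Require Import structures.
From mathcomp Require Import all_boot all_order all_algebra.
From mathcomp Require Import complex ring lra.
From mathcomp Require Import all_classical all_reals all_analysis.

Set Implicit Arguments.
Unset Strict Implicit.
Unset Printing Implicit Defensive.

Import Order.TTheory GRing.Theory Num.Theory.
Import numFieldNormedType.Exports.

Local Open Scope classical_set_scope.
Local Open Scope sesquilinear_scope.
Local Open Scope ring_scope.
Local Open Scope complex_scope.

(** * Euclidean vector norm and induced operator norm *)

Section EuclideanNorm.
Variable R : realType.
Local Notation C := R[i].

Lemma normcE_real (x : C) : `|x| = (Normc.normc x)%:C.
Proof. by []. Qed.

Lemma normc_ge0 (x : C) : 0 <= Normc.normc x.
Proof. by rewrite -lecR; exact: (@normr_ge0 _ C). Qed.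

Lemma l2norm_ge0 N (v : 'cV[C]_N) : 0 <= l2norm v.
Proof. exact: sqrtr_ge0. Qed.

Lemma l2norm_sqr N (v : 'cV[C]_N) : (l2norm v ^+ 2)%:C = (v^t* *m v) 0 0.
Proof.
rewrite /l2norm sqr_sqrtr; last by apply: sumr_ge0 => i _; apply: sqr_ge0.
rewrite mxE rmorph_sum /=; apply: eq_bigr => i _.
by rewrite rmorphXn /= -normcE_real !mxE normCK mulrC.
Qed.

(** This gives access to the triangle inequality of the Hermitian form [dotmx], which lives on row
    vectors. *)
Lemma l2norm_sqrtC N (v : 'cV[C]_N) : (l2norm v)%:C = sqrtC (dotmx v^T v^T).
Proof.
have -> : dotmx v^T v^T = (l2norm v)%:C ^+ 2.
  rewrite -rmorphXn /= l2norm_sqr dotmxE !mxE.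
  by apply: eq_bigr => i _; rewrite !mxE mulrC.
by rewrite sqrCK // (lecR 0) l2norm_ge0.
Qed.

Lemma l2normD N (u v : 'cV[C]_N) : l2norm (u + v) <= l2norm u + l2norm v.
Proof.
by rewrite -lecR rmorphD /= !l2norm_sqrtC linearD; exact: triangle_lerif.
Qed.

Lemma l2normZ N (a : C) (v : 'cV[C]_N) :
  l2norm (a *: v) = Normc.normc a * l2norm v.
Proof.
rewrite /l2norm -[Normc.normc a]ger0_norm ?normc_ge0// -sqrtr_sqr -sqrtrM ?sqr_ge0//.
congr Num.sqrt; rewrite mulr_sumr; apply: eq_bigr => i _.
by rewrite mxE Normc.normcM exprMn.
Qed.

Lemma l2norm0 N : l2norm (0 : 'cV[C]_N) = 0.
Proof. by rewrite -(scale0r 0) l2normZ Normc.normc0 mul0r. Qed.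

Lemma l2normN N (v : 'cV[C]_N) : l2norm (- v) = l2norm v.
Proof. by rewrite -scaleN1r l2normZ normcN Normc.normc1 mul1r. Qed.

Lemma l2normB N (u v : 'cV[C]_N) : l2norm (u - v) <= l2norm u + l2norm v.
Proof. by rewrite -(l2normN v) l2normD. Qed.

Lemma l2norm_sum N (I : finType) (v : I -> 'cV[C]_N) :
  l2norm (\sum_i v i) <= \sum_i l2norm (v i).
Proof.
elim/big_ind2 : _ => [|a b c d ab cd|//]; first by rewrite l2norm0.
exact: le_trans (l2normD _ _) (lerD _ _).
Qed.

Lemma normc_le_l2norm N (v : 'cV[C]_N) i : Normc.normc (v i 0) <= l2norm v.
Proof.
rewrite -[leLHS]ger0_norm ?normc_ge0// -sqrtr_sqr ler_wsqrtr//.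
by rewrite (bigD1 i)//= lerDl sumr_ge0// => j _; rewrite sqr_ge0.
Qed.

Lemma l2norm_eq0 N (v : 'cV[C]_N) : (l2norm v == 0) = (v == 0).
Proof.
apply/eqP/eqP => [v0|->]; last exact: l2norm0.
apply/colP => i; rewrite mxE; apply: Normc.eq0_normc; apply/eqP.
by rewrite eq_le normc_ge0 andbT -v0 normc_le_l2norm.
Qed.

Lemma l2norm_gt0 N (v : 'cV[C]_N) : (0 < l2norm v) = (v != 0).
Proof. by rewrite lt_def l2norm_ge0 l2norm_eq0 andbT. Qed.

(** Entries of [z] are bounded by its norm, so the triangle inequality costs a factor [N]. Errors
    known column by column become errors of the product. *)
Lemma l2norm_col_comb M N (c : R) (A : 'M[C]_(M, N)) (z : 'cV[C]_N) :
  (forall j, l2norm (col j A) <= c) -> l2norm (A *m z) <= N%:R * c * l2norm z.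
Proof.
move=> Ac; have -> : A *m z = \sum_j z j 0 *: col j A.
  apply/colP => i; rewrite mxE summxE; apply: eq_bigr => j _.
  by rewrite !mxE mulrC.
apply: le_trans (l2norm_sum _) _.
apply: (@le_trans _ _ (\sum_(j < N) c * l2norm z)); last first.
  by rewrite sumr_const card_ord -[leRHS]mulrA [leRHS]mulr_natl.
apply: ler_sum => j _; rewrite l2normZ mulrC.
by rewrite ler_pM ?l2norm_ge0 ?normc_ge0 ?normc_le_l2norm.
Qed.

Lemma l2norm_mulmx_bounded M N (A : 'M[C]_(M, N)) :
  exists2 c : R, 0 <= c & forall z, l2norm (A *m z) <= c * l2norm z.
Proof.
exists (N%:R * \sum_j l2norm (col j A)); last first.
  move=> z; apply: l2norm_col_comb => j.
  by rewrite (bigD1 j)//= lerDl sumr_ge0// => i _; rewrite l2norm_ge0.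
by rewrite mulr_ge0// sumr_ge0// => i _; rewrite l2norm_ge0.
Qed.

Lemma l2norm_pythagoras N (u v : 'cV[C]_N) : u^t* *m v = 0 ->
  l2norm (u + v) ^+ 2 = l2norm u ^+ 2 + l2norm v ^+ 2.
Proof.
move=> uv; have vu : v^t* *m u = 0.
  by rewrite -[v^t* *m u]trmxCK trmxC_mul trmxCK uv trmx0 map_mx0.
have uvE : (u + v)^t* = u^t* + v^t*.
  by apply/matrixP => i j; rewrite !mxE rmorphD.
suff : (l2norm (u + v) ^+ 2)%:C = (l2norm u ^+ 2 + l2norm v ^+ 2)%:C by case.
rewrite rmorphD /= !l2norm_sqr uvE mulmxDl !mulmxDr uv vu.
by rewrite addr0 add0r mxE.
Qed.

Lemma l2norm_projection N (P : 'M[C]_N) (u : 'cV[C]_N) :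
  P^t* = P -> P *m P = P ->
  l2norm u ^+ 2 = l2norm (P *m u) ^+ 2 + l2norm (u - P *m u) ^+ 2.
Proof.
move=> Ph PP; rewrite -l2norm_pythagoras ?subrKC//.
by rewrite trmxC_mul Ph mulmxBr -!mulmxA (mulmxA P) PP subrr.
Qed.

Lemma l2norm_delta N (i : 'I_N) : l2norm (delta_mx i 0 : 'cV[C]_N) = 1.
Proof.
rewrite /l2norm (bigD1 i)//= big1 => [|j ji].
  by rewrite mxE !eqxx Normc.normc1 expr1n addr0 sqrtr1.
by rewrite mxE (negbTE ji) Normc.normc0 expr0n.
Qed.

(** With [N.+1] columns the unit sphere is nonempty, so the [sup] is a genuine supremum. *)
Lemma has_sup_l2opnorm M N (A : 'M[C]_(M, N.+1)) :
  has_sup [set l2norm (A *m z) | z in [set z | l2norm z = 1]].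
Proof.
split.
  by exists (l2norm (A *m delta_mx 0 0)), (delta_mx 0 0) => //=; rewrite l2norm_delta.
have [c c0 Ac] := l2norm_mulmx_bounded A.
by exists c => _ [z /= z1 <-]; rewrite (le_trans (Ac z))// z1 mulr1.
Qed.

Lemma l2opnormP M N (A : 'M[C]_(M, N.+1)) z :
  l2norm (A *m z) <= l2opnorm A * l2norm z.
Proof.
have [->|z0] := eqVneq z 0; first by rewrite mulmx0 !l2norm0 mulr0.
have lz : 0 < l2norm z by rewrite l2norm_gt0.
rewrite -ler_pdivrMr//; apply: sup_upper_bound; first exact: has_sup_l2opnorm.
have nV : Normc.normc ((l2norm z)^-1)%:C = (l2norm z)^-1.
  by rewrite /= expr0n addr0 sqrtr_sqr ger0_norm// invr_ge0 ltW.
exists (((l2norm z)^-1)%:C *: z) => /=.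
  by rewrite l2normZ nV mulVf// gt_eqF.
by rewrite -scalemxAr l2normZ nV mulrC.
Qed.

Lemma l2opnorm_ge0 M N (A : 'M[C]_(M, N.+1)) : 0 <= l2opnorm A.
Proof.
have [[_ [z /= z1 _]] _] := has_sup_l2opnorm A.
by have := l2opnormP A z; rewrite z1 mulr1; apply: le_trans; exact: l2norm_ge0.
Qed.

End EuclideanNorm.

(** * Least squares by the Moore-Penrose inverse, and injectivity of [Wtilde] *)

Section MoorePenrose.
Variable R : realType.
Local Notation C := R[i].

(** By the Penrose equations [A *m mp_inverse A] is Hermitian and idempotent, hence an orthogonal
    projector. *)
Lemma mp_inverse_range_proj M N (A : 'M[C]_(M, N)) (u : 'cV[C]_M) :
  l2norm u ^+ 2 = l2norm (A *m mp_inverse A *m u) ^+ 2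
                  + l2norm (u - A *m mp_inverse A *m u) ^+ 2.
Proof.
have [AXA _ AXh _] := mp_inverseP A.
by apply: l2norm_projection => //; rewrite mulmxA AXA.
Qed.

(** The projector fixes [A *m z], so [u] and [u + A *m z] have the same residual. *)
Lemma mp_inverse_least_squares M N (A : 'M[C]_(M, N)) (u : 'cV[C]_M) z :
  l2norm (u - A *m mp_inverse A *m u) <= l2norm (u + A *m z).
Proof.
have [AXA _ _ _] := mp_inverseP A.
rewrite -ler_sqr ?nnegrE ?l2norm_ge0// (mp_inverse_range_proj A (u + A *m z)).
rewrite mulmxDr mulmxA AXA [X in u + _ - X]addrC addrKA.
by rewrite lerDr sqr_ge0.
Qed.

(** The projector does not increase norms, so a lower bound on [A] becomes an upper bound on its
    pseudo-inverse. *)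
Lemma l2norm_mp_inverse M N (A : 'M[C]_(M, N)) (c : R) (u : 'cV[C]_M) :
  (forall z, c * l2norm z <= l2norm (A *m z)) ->
  c * l2norm (mp_inverse A *m u) <= l2norm u.
Proof.
move=> cA; apply: (le_trans (cA _)).
rewrite -ler_sqr ?nnegrE ?l2norm_ge0// [leRHS](mp_inverse_range_proj A).
by rewrite mulmxA lerDl sqr_ge0.
Qed.

(** Injectivity turns the first Penrose equation into [mp_inverse A *m A = 1]. *)
Lemma mp_inverse_injective M N (A : 'M[C]_(M.+1, N)) :
  (forall z : 'cV_N, A *m z = 0 -> z = 0) ->
  forall z, l2norm z <= l2opnorm (mp_inverse A) * l2norm (A *m z).
Proof.
move=> Ainj z; have [AXA _ _ _] := mp_inverseP A.
have {1}-> : z = mp_inverse A *m (A *m z).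
  apply/eqP; rewrite -subr_eq0; apply/eqP; apply: Ainj.
  by rewrite mulmxBr !mulmxA AXA subrr.
exact: l2opnormP.
Qed.

Lemma col_seq_mx N (v : nat -> 'cV[C]_N) n k (j : 'I_k) :
  col j (seq_mx v n k) = v (n + j)%N.
Proof. by apply/colP => i; rewrite !mxE. Qed.

Lemma seq_mx_mul N (v : nat -> 'cV[C]_N) n k (z : 'cV_k) :
  seq_mx v n k *m z = \sum_(j < k) z j 0 *: v (n + j)%N.
Proof.
apply/colP => i; rewrite mxE summxE; apply: eq_bigr => j _.
by rewrite !mxE mulrC.
Qed.

Lemma Wtilde_mul N (F : 'M[C]_N.+1) (e : 'cV_N.+1) k (z : 'cV_k) :
  Wtilde F e k *m z =
  (F - 1) ^+ 2 *m (horner_mx F (\sum_(j < k) z j 0 *: 'X^j) *m e).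
Proof.
rewrite seq_mx_mul raddf_sum /= mulmx_suml mulmx_sumr; apply: eq_bigr => j _.
by rewrite linearZ/= rmorphXn/= horner_mx_X -scalemxAl -scalemxAr mulmxA.
Qed.

(** As [1 - F] is invertible, a kernel vector yields [Q] of size at most [k] with [Q(F) e = 0]; if
    nonzero, its monic multiple contradicts the minimality of [P]. *)
Lemma Wtilde_injective N (F : 'M[C]_N.+1) (e : 'cV_N.+1) k P :
  1 - F \in unitmx -> minpoly_wrt F e P -> (k < (size P).-1)%N ->
  forall z : 'cV_k, Wtilde F e k *m z = 0 -> z = 0.
Proof.
move=> Gu [_ _ Pmin] kP z; rewrite Wtilde_mul; set Q := \sum_(j < k) _.
have -> : (F - 1) ^+ 2 = (1 - F) *m (1 - F) by rewrite -opprB sqrrN expr2.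
rewrite -mulmxA => /(congr1 (mulmx (invmx (1 - F)))).
rewrite mulKmx// mulmx0 => /(congr1 (mulmx (invmx (1 - F)))).
rewrite mulKmx// mulmx0 => Qe.
have QE i (ik : (i < k)%N) : Q`_i = z (Ordinal ik) 0.
  rewrite coef_sum (bigD1 (Ordinal ik))//= coefZ coefXn eqxx mulr1.
  rewrite big1 ?addr0// => j ji; rewrite coefZ coefXn.
  by case: eqP => [ij|]; [case/eqP: ji; exact/val_inj|rewrite mulr0].
have Qk : (size Q <= k)%N.
  apply: (leq_trans (size_sum _ _ _)); apply/bigmax_leqP => j _.
  by apply: (leq_trans (size_scale_leq _ _)); rewrite size_polyXn.
have [Q0|Q0] := eqVneq Q 0.
  by apply/colP => -[i ik]; rewrite -QE Q0 coef0 mxE.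
have lQ : lead_coef Q != 0 by rewrite lead_coef_eq0.
have := Pmin ((lead_coef Q)^-1 *: Q).
rewrite size_scale ?invr_eq0// monicE lead_coefZ mulVf// eqxx.
rewrite linearZ/= -scalemxAl Qe scaler0 => /(_ isT erefl) PQ.
move: (leq_ltn_trans (leq_trans PQ Qk) kP).
by case: (size P) => //= m; rewrite ltnNge leqnSn.
Qed.

(** Since [g - 1] vanishes at 1, [z] can list the coefficients of its quotient by ['X - 1]. *)
Lemma factor_sub1 (g : {poly C}) k : (size g <= k.+1)%N -> g.[1] = 1 ->
  exists z : 'cV[C]_k, g = 1 + (\sum_(j < k) z j 0 *: 'X^j) * ('X - 1).
Proof.
move=> gk g1; have /factor_theorem[h] : root (g - 1) 1.
  by rewrite /root hornerD hornerN hornerC g1 subrr.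
move=> gE; have hk : (size h <= k)%N.
  have [->|h0] := eqVneq h 0; first by rewrite size_poly0.
  have sh : size (h * ('X - 1%:P)) = (size h).+1.
    by rewrite size_Mmonic ?monicXsubC// size_XsubC addn2.
  rewrite -ltnS -sh -gE (leq_trans (size_polyD _ _))// geq_max gk size_polyN.
  by rewrite size_poly1.
exists (\col_j h`_j); rewrite -[g in LHS](subrKC 1) gE; congr (_ + _ * _).
rewrite -[LHS](coefK h) poly_def (big_ord_widen _ (fun i => h`_i *: 'X^i) hk).
rewrite big_mkcond; apply: eq_bigr => j _; rewrite mxE.
by case: ltnP => // hj; rewrite nth_default// scale0r.
Qed.

End MoorePenrose.

(** * Differences of a nearly linear sequence *)

Section Perturbation.
Variables (R : realType) (N : nat).
Local Notation C := R[i].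
Variables (F : 'M[C]_N.+1) (n k : nat).
Let G := 1 - F.
Variables (x : nat -> 'cV[C]_N.+1) (s : 'cV[C]_N.+1) (c : R).
Let e := x n - s.
Let u := seq_diff x.
Let w := seq_diff u.

(** The deviation from the linear iteration with matrix [F] started at the error of [x n]. *)
Definition lin_residual j := x (n + j)%N - s - F ^+ j *m (x n - s).
Local Notation r := lin_residual.
Hypothesis rc : forall j, (j <= k.+1)%N -> l2norm (r j) <= c.

(** An exactly linear sequence has first differences [- G F^j e], so only residuals remain. *)
Lemma lin_residual_diff1 j : u (n + j)%N + G *m (F ^+ j *m e) = r j.+1 - r j.
Proof.
rewrite /u /seq_diff /lin_residual -/e addnS exprS -!mulmxA /G mulmxBl mul1mx.
set q := F ^+ j *m e; set p := F *m q.
by clearbody p; clearbody q; apply/colP => i; rewrite !mxE; ring.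
Qed.

Lemma lin_residual_diff2 j : w (n + j)%N - G *m (G *m (F ^+ j *m e)) =
  (r j.+2 - r j.+1) - (r j.+1 - r j).
Proof.
rewrite -!lin_residual_diff1 /w /seq_diff addnS exprS -mulmxA.
rewrite {2}/G [X in _ - G *m X]mulmxBl mul1mx mulmxBr.
set p := G *m (F *m _); set q := G *m _.
by clearbody p; clearbody q; apply/colP => i; rewrite !mxE; ring.
Qed.

Lemma l2norm_diff1 j : (j <= k)%N ->
  l2norm (u (n + j)%N + G *m (F ^+ j *m e)) <= 2 * c.
Proof.
move=> jk; rewrite lin_residual_diff1 (le_trans (l2normB _ _))//.
by rewrite -[2]/(1 + 1) mulrDl mul1r lerD// rc// ltnW.
Qed.

Lemma l2norm_diff2 j : (j < k)%N ->
  l2norm (w (n + j)%N - G *m (G *m (F ^+ j *m e))) <= 4 * c.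
Proof.
move=> jk; rewrite lin_residual_diff2.
have -> : 4 * c = (c + c) + (c + c) by ring.
by do 2![rewrite (le_trans (l2normB _ _))// lerD//]; rewrite rc// ltnW// ltnW.
Qed.

Lemma l2norm_Wtilde_perturb (z : 'cV_k) :
  l2norm (seq_mx w n k *m z - Wtilde F e k *m z) <= k%:R * (4 * c) * l2norm z.
Proof.
rewrite -mulmxBl; apply: l2norm_col_comb => j.
suff -> : col j (seq_mx w n k - Wtilde F e k) =
    w (n + j)%N - G *m (G *m (F ^+ j *m e)) by exact: l2norm_diff2.
rewrite linearB/= !col_seq_mx; congr (_ - _).
by rewrite -[F - 1]opprB sqrrN expr2 -!mulmxA add0n.
Qed.

(** In the exactly linear case [w = (F - 1) u = - G u], so the sum on the left consists of errors
    only. *)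
Lemma l2norm_diff2_diff1 b (z : 'cV_k) :
  (forall y : 'cV_N.+1, l2norm (G *m y) <= b * l2norm y) -> 0 <= b ->
  l2norm (seq_mx w n k *m z + G *m (seq_mx u n k *m z))
    <= k%:R * (4 * c + b * (2 * c)) * l2norm z.
Proof.
move=> Gb b0; rewrite mulmxA -mulmxDl; apply: l2norm_col_comb => j.
set q := F ^+ j *m e.
have -> : col j (seq_mx w n k + G *m seq_mx u n k) =
    (w (n + j)%N - G *m (G *m q)) + G *m (u (n + j)%N + G *m q).
  rewrite linearD/= !colE -mulmxA -!colE !col_seq_mx.
  by rewrite (mulmxDr G (u _)) addrACA addNr addr0.
rewrite (le_trans (l2normD _ _))// lerD ?l2norm_diff2//.
by rewrite (le_trans (Gb _))// ler_wpM2l// l2norm_diff1// ltnW.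
Qed.

End Perturbation.

(** * One extrapolation step on a nearly linear sequence *)

(** The threshold [d] is chosen before [x] and [s]; this uniformity lets one [d] serve every
    cycle. *)
Lemma rre_contraction (R : realType) (N : nat) (F : 'M[R[i]]_N.+1) (n k : nat)
    (eta tau : R) (g : {poly R[i]}) :
  let G := 1 - F in
  0 < eta -> 0 < tau -> (size g <= k.+1)%N -> g.[1] = 1 ->
  exists2 d : R, 0 < d &
    forall (x : nat -> 'cV[R[i]]_N.+1) s,
      let e := x n - s in
      0 < wnorm G e ->
      (forall j, (j <= k.+1)%N ->
         l2norm (lin_residual F n x s j) <= d * wnorm G e) ->
      (forall z : 'cV_k, Wtilde F e k *m z = 0 -> z = 0) ->
      l2opnorm (mp_inverse (Wtilde F e k)) <= eta / wnorm G e ->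
      wnorm G (rre x n k - s) <= (l2opnorm (horner_mx F g) + tau) * wnorm G e.
Proof.
move=> G eta0 tau0 gk g1.
have [z gE] := factor_sub1 gk g1.
have [b b0 Gb] := l2norm_mulmx_bounded G.
pose K : R := k%:R; have K0 : 0 <= K by rewrite ler0n.
have z0 := l2norm_ge0 z.
(* [M] dominates the coefficients of [d] in all error terms below: [d * M <= 1] serves the bounds on
   [W] and [u n], and [d * M <= tau] the final estimate. *)
pose M := 6 + 4 * K * l2norm z + 4 * K * eta * (4 + 2 * b) + 8 * K * eta.
have Kz0 : 0 <= K * l2norm z by rewrite mulr_ge0.
have Ke0 : 0 <= K * eta by rewrite mulr_ge0// ltW.
have Keb0 : 0 <= K * eta * b by rewrite mulr_ge0.
have M0 : 0 < M by rewrite /M; nra.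
pose d := Num.min 1 tau / M.
have d0 : 0 < d by rewrite divr_gt0// lt_min ltr01.
have dM1 : d * M <= 1 by rewrite divfK ?gt_eqF// ge_min lexx.
have dMt : d * M <= tau by rewrite divfK ?gt_eqF// ge_min lexx orbT.
exists d => // x s e; set E := wnorm G e => E0 rd Winj Wpinv.
have c0 : 0 <= d * E by rewrite mulr_ge0 ?ltW.
set u := seq_diff x; set w := seq_diff u.
set W := seq_mx w n k; set U := seq_mx u n k.
have u0 : l2norm (u n + G *m e) <= 2 * (d * E).
  by have := l2norm_diff1 rd (leq0n k); rewrite addn0 expr0 mul1mx.
have WW y := l2norm_Wtilde_perturb rd y.
have WU y := l2norm_diff2_diff1 rd y Gb b0.
(* The pseudo-inverse hypothesis bounds [Wtilde] below by [E / eta]; the perturbation takes away at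
   most half of it. *)
have Wlow y : E / (2 * eta) * l2norm y <= l2norm (W *m y).
  have y0 := l2norm_ge0 y.
  have h1 : l2norm y * E <= eta * l2norm (Wtilde F e k *m y).
    rewrite -ler_pdivlMr// mulrAC.
    apply: (le_trans (mp_inverse_injective Winj y)).
    by rewrite ler_wpM2r// l2norm_ge0.
  have h2 : l2norm (Wtilde F e k *m y) <=
      l2norm (W *m y) + K * (4 * (d * E)) * l2norm y.
    rewrite -[Wtilde F e k *m y](subKr (W *m y)).
    by rewrite (le_trans (l2normB _ _))// lerD2l WW.
  have h3 : K * eta * d * 8 <= 1.
    by apply: le_trans dM1; rewrite /M; nra.
  rewrite mulrAC ler_pdivrMr ?mulr_gt0//.
  have h4 : (K * eta * d * 8) * (E * l2norm y) <= E * l2norm y.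
    by rewrite ler_piMl// mulr_ge0// ltW.
  have h5 := ler_wpM2l (ltW eta0) h2.
  by nra.
set xi := mp_inverse W *m u n.
have un : l2norm (u n) <= 2 * E.
  rewrite -[u n](addrK (G *m e)) (le_trans (l2normB _ _))//.
  have h : 2 * d <= 1 by apply: le_trans dM1; rewrite /M; nra.
  by rewrite -/(wnorm G e) -/E; nra.
(* This bound is free of [E], so the error of [W + G U] applied to [xi] stays of order [d * E]. *)
have xin : l2norm xi <= 4 * eta.
  have := le_trans (l2norm_mp_inverse (u n) Wlow) un.
  rewrite -/xi mulrAC ler_pdivrMr ?mulr_gt0// => h.
  by rewrite -(ler_pM2l E0); nra.
have GE : G = horner_mx F (1 - 'X) by rewrite rmorphB rmorph1/= horner_mx_X.
(* If [h] has coefficients [z], then [1 - g = h (1 - X)], hence [h (1 - X)^2 = (1 - g)(1 - X)]. *)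
have gF : Wtilde F e k *m z = G *m e - horner_mx F g *m (G *m e).
  rewrite Wtilde_mul -[F - 1]opprB sqrrN -/G mulmxA mulmxA -mulmxBl.
  congr (_ *m _); rewrite {}gE GE !mulmxE -rmorphXn/= -!rmorphM -rmorphB/=.
  by congr (horner_mx F _); ring.
have ls : l2norm (u n - W *m xi) <=
    l2opnorm (horner_mx F g) * E + 2 * (d * E) + K * (4 * (d * E)) * l2norm z.
  (* The minimal residual is compared with the one for the fixed vector [z], whose main term is
     [- g(F) G e]. *)
  rewrite mulmxA; apply: (le_trans (mp_inverse_least_squares _ _ z)).
  have -> : u n + W *m z = - (horner_mx F g *m (G *m e)) + (u n + G *m e)
      + (W *m z - Wtilde F e k *m z).
    rewrite gF; set p := horner_mx F g *m _; set q := G *m e.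
    clearbody p; clearbody q.
    by apply/colP => i; rewrite !mxE; ring.
  rewrite (le_trans (l2normD _ _))// lerD//.
  rewrite (le_trans (l2normD _ _))// lerD// l2normN.
  exact: l2opnormP.
(* Applying G to the new error turns the increments in U into the second
   differences in W, up to a perturbation; what is left is the least-squares
   residual of u_n. *)
have -> : wnorm G (rre x n k - s) =
    l2norm ((u n + G *m e) - (u n - W *m xi) - (W *m xi + G *m (U *m xi))).
  rewrite /wnorm /rre -/u -/w -/W -/U addrAC -/e mulmxBr -mulmxA -/xi.
  congr l2norm; set p := W *m xi; set q := G *m (U *m xi); set q' := G *m e.
  clearbody p; clearbody q; clearbody q'.
  by apply/colP => i; rewrite !mxE; ring.
rewrite (le_trans (l2normB _ _))//.
apply: le_trans (lerD (le_trans (l2normB _ _) (lerD u0 ls)) (WU xi)) _.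
rewrite -/K.
have h1 : K * (4 * (d * E) + b * (2 * (d * E))) * l2norm xi
    <= K * (4 * (d * E) + b * (2 * (d * E))) * (4 * eta).
  rewrite ler_wpM2l// mulr_ge0//.
  by have bc0 := mulr_ge0 b0 c0; lra.
apply: le_trans (lerD (lexx _) h1) _.
have h2 : d * M * E <= tau * E by rewrite ler_wpM2r// ltW.
have h3 : 0 <= d * E * (K * eta * 8) by apply: mulr_ge0 => //; lra.
by move: h2; rewrite /M; lra.
Qed.

(** * Linearization of the iterates at the fixed point *)

Section Linearization.
Variable R : realType.
Local Notation C := R[i].

(** The norm of matrices is the largest modulus of an entry, as a complex number. Comparison in both
    directions carries differentiability over to [l2norm]. *)
Lemma mx_norm_le_l2norm N (v : 'cV[C]_N) : `|v| <= (l2norm v)%:C.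
Proof.
have [v0|/mx_norm_neq0[[i j] vE]] := eqVneq (mx_norm v) 0.
  by rewrite [leLHS]v0 (lecR 0) l2norm_ge0.
by rewrite [leLHS]vE /= ord1 normcE_real lecR normc_le_l2norm.
Qed.

Lemma norm_entry_le_mx_norm M N (A : 'M[C]_(M, N)) i j : `|A i j| <= `|A|.
Proof.
by rewrite [leRHS]mx_normE -[leLHS]nngE num_le; exact: (le_bigmax _ _ (i, j)).
Qed.

Lemma cV_sum_delta N (v : 'cV[C]_N) : v = \sum_i v i 0 *: delta_mx i 0.
Proof. by rewrite {1}[v]matrix_sum_delta; under eq_bigr do rewrite big_ord1. Qed.

Lemma l2norm_le_mx_norm N (v : 'cV[C]_N) : (l2norm v)%:C <= N%:R * `|v|.
Proof.
have h : l2norm v <= \sum_i Normc.normc (v i 0).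
  rewrite {1}[v]cV_sum_delta (le_trans (l2norm_sum _))// ler_sum// => i _.
  by rewrite l2normZ l2norm_delta mulr1.
rewrite -lecR in h; apply: (le_trans h); rewrite rmorph_sum/=.
rewrite mulr_natl -[X in _ *+ X](card_ord N) -sumr_const ler_sum// => i _.
exact: norm_entry_le_mx_norm.
Qed.

Lemma diff_jacobian N (f : 'cV[C]_N.+1 -> 'cV[C]_N.+1) x v :
  differentiable f x -> 'd f x v = jacobian_mx f x *m v.
Proof.
move=> df; rewrite {1}[v]cV_sum_delta linear_sum/=; apply/colP => i.
rewrite summxE mxE; apply: eq_bigr => j _.
by rewrite linearZ/= !mxE deriveE// mulrC.
Qed.

Lemma differentiable_l2norm N (f : 'cV[C]_N.+1 -> 'cV[C]_N.+1) s (eps : R) :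
  differentiable f s -> 0 < eps ->
  exists2 d : R, 0 < d & forall y, l2norm (y - s) <= d ->
    l2norm (f y - f s - jacobian_mx f s *m (y - s)) <= eps * l2norm (y - s).
Proof.
move=> df eps0; have /eqaddoP := diff_locally df.
(* The divisor [N.+1] offsets the factor lost between the two norms. *)
have e0 : 0 < (eps / N.+1%:R)%:C :> C by rewrite ltcR divr_gt0.
move=> /(_ _ e0) /nbhs_ballP[[a b] /=].
rewrite ltcE/= => /andP[/eqP b0 a0]; rewrite b0 {b0}.
(* Half the radius, since the ball is open and the bound on [y] is not strict. *)
move=> fs; exists (a / 2); first by rewrite divr_gt0.
move=> y ya.
have /fs /= : ball (0 : 'cV[C]_N.+1) a%:C (y - s).
  rewrite -ball_normE /= sub0r normrN; apply: (le_lt_trans (mx_norm_le_l2norm _)).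
  by rewrite ltcR (le_lt_trans ya)// ltr_pdivrMr// ltr_pMr// ltr1n.
rewrite (_ : (f \o _ - _) _ = f y - f s - jacobian_mx f s *m (y - s)); last first.
  rewrite -diff_jacobian// -[LHS]/(f (y - s + s) - (f s + 'd f s (y - s))).
  by rewrite subrK opprD addrA.
move=> h.
rewrite -lecR (le_trans (l2norm_le_mx_norm _))//.
rewrite -ler_pdivlMl ?ltr0n// (le_trans h)//.
rewrite (le_trans (ler_wpM2l (ltW e0) (mx_norm_le_l2norm _)))//.
rewrite !rmorphM/= fmorphV rmorph_nat mulrA.
by rewrite [_%:C / _]mulrC.
Qed.
(** By induction: the new residual is the linearization error of [f] at the [j]-th iterate plus [F]
    applied to the old residual. Each part gets half of [eps]. *)
Lemma iter_l2norm N (f : 'cV[C]_N.+1 -> 'cV[C]_N.+1) s (eps : R) j :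
  differentiable f s -> f s = s -> 0 < eps ->
  exists2 d : R, 0 < d & forall y, l2norm (y - s) <= d ->
    l2norm (iter j f y - s - jacobian_mx f s ^+ j *m (y - s))
      <= eps * l2norm (y - s).
Proof.
move=> df fs; elim: j eps => [|j IH] eps eps0.
  exists 1 => // y _; rewrite expr0 mul1mx subrr l2norm0.
  by rewrite mulr_ge0 ?l2norm_ge0// ltW.
set F := jacobian_mx f s in IH *.
have [b b0 Fb] := l2norm_mulmx_bounded F.
have [c c0 Fjc] := l2norm_mulmx_bounded (F ^+ j).
have e1 : 0 < eps / 2 / (b + 1) by rewrite !divr_gt0// ltr_wpDl.
(* The divisor bounds the growth of the distance to [s] over [j] iterations. *)
have e2 : 0 < eps / 2 / (c + eps / 2 / (b + 1)) by rewrite !divr_gt0// ltr_wpDl.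
have [d1 d10 H1] := IH _ e1.
have [d2 d20 H2] := differentiable_l2norm df e2.
have cd : 0 < c + eps / 2 / (b + 1) by rewrite ltr_wpDl.
exists (Num.min d1 (d2 / (c + eps / 2 / (b + 1)))).
  by rewrite lt_min d10 divr_gt0.
move=> y; rewrite le_min => /andP[/H1 {}H1]; rewrite ler_pdivlMr// => yd.
set z := iter j f y in H1 *.
have zs : l2norm (z - s) <= (c + eps / 2 / (b + 1)) * l2norm (y - s).
  rewrite -[z - s](subrK (F ^+ j *m (y - s))) (le_trans (l2normD _ _))//.
  by rewrite mulrDl addrC lerD.
have {}H2 : l2norm (f z - s - F *m (z - s)) <= eps / 2 * l2norm (y - s).
  rewrite -{1}fs (le_trans (H2 _ _))//; first by rewrite (le_trans zs)// mulrC.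
  rewrite mulrAC ler_pdivrMr// -[leRHS]mulrA [_ * (c + _)]mulrC.
  by rewrite ler_wpM2l// divr_ge0// ltW.
have {}H1 : l2norm (F *m (z - s - F ^+ j *m (y - s))) <= eps / 2 * l2norm (y - s).
  apply: (le_trans (Fb _)); apply: (le_trans (ler_wpM2l b0 H1)).
  rewrite mulrA ler_wpM2r ?l2norm_ge0// mulrCA ger_pMr ?divr_gt0//.
  by rewrite ler_pdivrMr ?ltr_wpDl// mul1r lerDl.
rewrite iterS -/z exprS -mulmxA.
have -> : f z - s - F *m (F ^+ j *m (y - s)) =
    (f z - s - F *m (z - s)) + F *m (z - s - F ^+ j *m (y - s)).
  by rewrite (mulmxBr F (z - s)) addrA subrK.
by rewrite (le_trans (l2normD _ _))// (le_trans (lerD H2 H1))// -mulrDl -splitr.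
Qed.

(** Invertibility of [G] makes the norms comparable; the minimum of finitely many radii gives
    uniformity in [j]. *)
Lemma iter_wnorm N (f : 'cV[C]_N.+1 -> 'cV[C]_N.+1) s (eps : R) (G : 'M[C]_N.+1) m :
  differentiable f s -> f s = s -> 0 < eps -> G \in unitmx ->
  exists2 d : R, 0 < d & forall y, wnorm G (y - s) <= d ->
    forall j, (j <= m)%N ->
    l2norm (iter j f y - s - jacobian_mx f s ^+ j *m (y - s))
      <= eps * wnorm G (y - s).
Proof.
move=> df fs eps0 Gu.
have [c c0 Gc] := l2norm_mulmx_bounded (invmx G).
have cd : 0 < c + 1 by rewrite ltr_wpDl.
have Gl y : l2norm (y - s) <= (c + 1) * wnorm G (y - s).
  rewrite -{1}(mulKmx Gu (y - s)) (le_trans (Gc _))// ler_wpM2r ?l2norm_ge0//.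
  by rewrite lerDl.
have step j : exists2 d : R, 0 < d & forall y, wnorm G (y - s) <= d ->
    l2norm (iter j f y - s - jacobian_mx f s ^+ j *m (y - s))
      <= eps * wnorm G (y - s).
  have e1 : 0 < eps / (c + 1) by rewrite divr_gt0.
  have [d d0 H] := iter_l2norm j df fs e1.
  exists (d / (c + 1)); first by rewrite divr_gt0.
  move=> y; rewrite ler_pdivlMr// mulrC => yd.
  rewrite (le_trans (H y (le_trans (Gl y) yd)))//.
  by rewrite mulrAC ler_pdivrMr// -[leRHS]mulrA [_ * (c + 1)]mulrC ler_wpM2l// ltW.
elim: m => [|m [d d0 IH]].
  by have [d d0 H] := step 0; exists d => // y yd j; rewrite leqn0 => /eqP->; exact: H.
have [d' d'0 H] := step m.+1.
exists (Num.min d d'); first by rewrite lt_min d0.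
move=> y; rewrite le_min => /andP[yd yd'] j; rewrite leq_eqVlt => /predU1P[->|jm].
  exact: H.
exact: IH.
Qed.

End Linearization.

(** * Spectral facts, [theta], and the error of one cycle *)

Section Main.
Variable R : realType.
Local Notation C := R[i].

(** If [1 - A] were singular, 1 would be an eigenvalue; the eigenvalues are bounded, so the [sup]
    would be at least 1. *)
Lemma spectral_radius_lt1 N (A : 'M[C]_N.+1) :
  spectral_radius A < 1 -> 1 - A \in unitmx.
Proof.
move=> rho; rewrite -row_free_unit -kermx_eq0; apply/rowV0P => v /sub_kermxP vA.
apply/eqP; apply: contraLR rho => v0; rewrite -leNgt.
apply: sup_ubound; last first.
  exists 1; last by rewrite Normc.normc1.
  apply/eigenvalueP; exists v => //.
  by move: vA; rewrite mulmxBr mulmx1 scale1r => /eqP; rewrite subr_eq0 => /eqP.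
(* Eigenvectors are rows here, hence the transpose. *)
have [c c0 Ac] := l2norm_mulmx_bounded A^T.
exists c => _ [a /= /eigenvalueP[u uA u0] <-].
have u0' : 0 < l2norm u^T by rewrite l2norm_gt0 trmx_eq0.
have := Ac u^T; rewrite -trmx_mul uA linearZ/= l2normZ.
by rewrite ler_pM2r.
Qed.

Lemma wopnorm_comm N (A : 'M[C]_N.+1) : 1 - A \in unitmx ->
  wopnorm (1 - A) A = l2opnorm A.
Proof.
move=> Gu; rewrite /wopnorm; congr l2opnorm.
suff -> : (1 - A) *m A = A *m (1 - A) by rewrite mulmxK.
by rewrite mulmxBl mulmxBr mul1mx mulmx1.
Qed.

Lemma l2opnorm_expr N (A : 'M[C]_N.+1) L n z : l2opnorm A <= L ->
  l2norm (A ^+ n *m z) <= L ^+ n * l2norm z.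
Proof.
move=> AL; elim: n => [|n IH]; first by rewrite !expr0 mul1mx mul1r.
rewrite !exprS -mulmxA -mulrA (le_trans (l2opnormP _ _))//.
by rewrite ler_pM ?l2opnorm_ge0 ?l2norm_ge0.
Qed.

Lemma has_inf_theta N (A : 'M[C]_N.+1) k :
  has_inf [set l2opnorm (horner_mx A g) |
        g in [set g : {poly R[i]} | (size g <= k.+1)%N /\ g.[1] = 1]].
Proof.
split; last by exists 0 => _ [g _ <-]; exact: l2opnorm_ge0.
exists (l2opnorm (horner_mx A 1)), 1 => //=.
by rewrite size_poly1 hornerC.
Qed.

Lemma theta_ge0 N (A : 'M[C]_N.+1) k : 0 <= theta A k.
Proof.
have [ne _] := has_inf_theta A k.
by apply: lb_le_inf => // _ [g _ <-]; exact: l2opnorm_ge0.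
Qed.

(** The competitor is ['X], admissible because [k] is positive. *)
Lemma theta_le N (A : 'M[C]_N.+1) k : (1 <= k)%N -> theta A k <= l2opnorm A.
Proof.
move=> k1; have [_ lb] := has_inf_theta A k.
apply: ge_inf => //; exists 'X; last by rewrite horner_mx_X.
by rewrite /= size_polyX hornerX.
Qed.

Lemma theta_approx N (A : 'M[C]_N.+1) k eps : 0 < eps ->
  exists g : {poly C}, [/\ (size g <= k.+1)%N, g.[1] = 1
    & l2opnorm (horner_mx A g) < theta A k + eps].
Proof.
move=> e0; have [_ [g [gk g1] <-] gt] := inf_adherent e0 (has_inf_theta A k).
by exists g.
Qed.

(** The upper limit is at most the supremum of any tail. *)
Lemma limn_esup_EFin_le (u : R^nat) (l : R) :
  (forall eps, 0 < eps -> \forall r \near \oo, u r <= l + eps) ->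
  (limn_esup (EFin \o u) <= l%:E)%E.
Proof.
move=> ul; apply/lee_addgt0Pr => eps /ul[M _ uM].
apply: (@le_trans _ _ (esups (EFin \o u) M)).
  rewrite limn_esup_lim; apply: lime_le; first exact: is_cvg_esups.
  by exists M => // m Mm; exact: nonincreasing_esups.
by apply: ge_ereal_sup => _ [m /= Mm <-]; rewrite lee_fin; exact: uM.
Qed.

(** The [n] plain iterations contribute [L ^+ n + tau], the extrapolation the other factor. *)
Lemma cycle_error N (f : 'cV[C]_N.+1 -> 'cV[C]_N.+1) s n k (eta tau L : R)
    (g : {poly C}) :
  let F := jacobian_mx f s in
  let G := 1 - F in
  differentiable f s -> f s = s -> G \in unitmx -> l2opnorm F <= L ->
  0 < eta -> 0 < tau -> (size g <= k.+1)%N -> g.[1] = 1 ->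
  exists2 d : R, 0 < d & forall y, wnorm G (y - s) <= d ->
    let x m := iter m f y in
    let e := x n - s in
    e != 0 ->
    (exists2 P, minpoly_wrt F e P & (k < (size P).-1)%N) ->
    l2opnorm (mp_inverse (Wtilde F e k)) <= eta / wnorm G e ->
    wnorm G (rre x n k - s) <=
      (l2opnorm (horner_mx F g) + tau) * (L ^+ n + tau) * wnorm G (y - s).
Proof.
move=> F G df fs Gu FL eta0 tau0 gk g1.
have L0 : 0 <= L := le_trans (l2opnorm_ge0 F) FL.
have [d1 d10 H1] := @rre_contraction R N F n k eta tau g eta0 tau0 gk g1.
have [d2 d20 H2] := iter_wnorm k.+1 df fs d10 Gu.
have [b b0 Gb] := l2norm_mulmx_bounded G.
have t1 : 0 < tau / (b + 1) by rewrite divr_gt0// ltr_wpDl.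
have [d3 d30 H3] := iter_wnorm n df fs t1 Gu.
have Lt0 : 0 < L ^+ n + tau by rewrite ltr_wpDl// exprn_ge0.
(* The second radius keeps [x n] within [d2] of [s], where the next [k.+1] iterates are nearly
   linear. *)
exists (Num.min d3 (d2 / (L ^+ n + tau))); first by rewrite lt_min d30 divr_gt0.
move=> y; rewrite le_min => /andP[/H3/(_ n (leqnn n)) {}H3].
rewrite ler_pdivlMr// => yd2 x e e0 [P eP kP] Wp.
have ee : wnorm G e <= (L ^+ n + tau) * wnorm G (y - s).
  rewrite /wnorm -[e](subrK (F ^+ n *m (y - s))) mulmxDr addrC mulrDl.
  rewrite (le_trans (l2normD _ _))// lerD//.
    (* [F ^+ n] commutes with [G], so its bound carries over to the weighted norm. *)
    suff -> : G *m (F ^+ n *m (y - s)) = F ^+ n *m (G *m (y - s)).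
      exact: l2opnorm_expr.
    rewrite !mulmxA; congr (_ *m _); apply: commrX.
    by rewrite /GRing.comm mulrBl mulrBr mul1r mulr1.
  rewrite (le_trans (Gb _))// (le_trans (ler_wpM2l b0 H3))//.
  rewrite mulrA ler_wpM2r ?l2norm_ge0// mulrCA ger_pMr//.
  by rewrite ler_pdivrMr ?ltr_wpDl// mul1r lerDl.
have E0 : 0 < wnorm G e.
  rewrite /wnorm l2norm_gt0; apply: contra e0 => /eqP Ge.
  by rewrite -(mulKmx Gu e) Ge mulmx0.
have ed2 : wnorm G e <= d2 by rewrite (le_trans ee)// mulrC.
rewrite -[leRHS]mulrA; apply: (@le_trans _ _ _ _ _ (H1 x s E0 _ _ Wp)).
- move=> j jk; rewrite /lin_residual /x addnC iterD -/(x n).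
  exact: H2.
- exact: Wtilde_injective eP kP.
- by rewrite ler_wpM2l// addr_ge0 ?l2opnorm_ge0// ltW.
Qed.

End Main.

(** * Convergence of the cycles and their asymptotic rate *)

Theorem theorem5p3 (R : realType) (N : nat)
    (f : 'cV[R[i]]_N.+1 -> 'cV[R[i]]_N.+1) (s : 'cV[R[i]]_N.+1)
    (n k : nat) (eta delta0 L : R) :
  let F := jacobian_mx f in
  let Ft := F s in
  let G := 1 - Ft in
  f s = s ->
  spectral_radius Ft < 1 ->
  (1 <= k)%N ->
  0 < eta ->
  0 < delta0 ->
  C2_on (wball G s delta0) f ->
  wopnorm G Ft <= L ->
  (exists2 x, wball G s delta0 x & wopnorm G (F x) = L) ->
  (forall x, wball G s delta0 x -> wopnorm G (F x) <= L) ->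
  L < 1 ->
  exists delta : R,
    [/\ 0 < delta, delta <= delta0 &
      forall x0 : 'cV[R[i]]_N.+1,
        let srec := cmode f n k x0 in
        let eps r m := cycle_iterate f n k x0 r m - s in
        wball G s delta x0 ->
        (forall r, (1 <= r)%N -> eps r n != 0) ->
        (forall r, (1 <= r)%N ->
           exists2 P, minpoly_wrt Ft (eps r n) P & (k < (size P).-1)%N) ->
        (forall r, (1 <= r)%N ->
           l2opnorm (mp_inverse (Wtilde Ft (eps r n) k))
             <= eta / wnorm G (eps r n)) ->
        [/\ srec r @[r --> \oo] --> s,
            (limn_esup (fun r =>
               (wnorm G (srec r.+1 - s) / wnorm G (srec r - s))%:E)
             <= (theta Ft k * L ^+ n)%:E)%E
          & theta Ft k * L ^+ n < 1]].
Proof.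
move=> F Ft G fs rho k1 eta0 delta00 [df _ _] FL _ _ L1.
have Gu : G \in unitmx by exact: spectral_radius_lt1.
rewrite wopnorm_comm// in FL.
have L0 : 0 <= L := le_trans (l2opnorm_ge0 Ft) FL.
have Ln1 : L ^+ n <= 1 by rewrite exprn_ile1// ltW.
have Ln0 : 0 <= L ^+ n by rewrite exprn_ge0.
have {}df : differentiable f s.
  by apply: df; rewrite /wball /= subrr /wnorm mulmx0 l2norm0 ltW.
have th0 := theta_ge0 Ft k.
have thL : theta Ft k <= L := le_trans (theta_le Ft k1) FL.
(* As [L = 1 - 4 tau], the product [(L + tau)(1 + tau) = (1 - 3 tau)(1 + tau)] is below 1. *)
pose tau := (1 - L) / 4; have tau0 : 0 < tau by rewrite /tau; lra.
pose q := (L + tau) * (L ^+ n + tau).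
have q0 : 0 <= q by rewrite mulr_ge0// addr_ge0// ltW.
have q1 : q < 1.
  apply: (@le_lt_trans _ _ ((L + tau) * (1 + tau))).
    by rewrite ler_wpM2l ?addr_ge0 ?lerD2r// ltW.
  by rewrite /tau; nra.
(* The choice [g = X] gives the factor [q] per cycle and fixes the radius before [x0] is given. *)
have sX : (size ('X : {poly R[i]}) <= k.+1)%N by rewrite size_polyX.
have [d d0 Hd] := cycle_error n df fs Gu FL eta0 tau0 sX (hornerX 1).
exists (Num.min d delta0); split; first by rewrite lt_min d0.
  by rewrite ge_min lexx orbT.
move=> x0 srec eps; rewrite /wball /= le_min => /andP[x0d _] eps0 epsP epsW.
(* Geometric decay also keeps every cycle in the ball where [Hd] applies. *)
have bound r : wnorm G (srec r - s) <= q ^+ r * d.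
  elim: r => [|r IH]; first by rewrite expr0 mul1r.
  have rd : wnorm G (srec r - s) <= d.
    by rewrite (le_trans IH)// ger_pMl// exprn_ile1// ltW.
  have := Hd _ rd (eps0 r.+1 isT) (epsP r.+1 isT) (epsW r.+1 isT).
  move=> /le_trans; apply; rewrite exprS -[leRHS]mulrA.
  have Lt0 : 0 <= L ^+ n + tau by rewrite addr_ge0// ltW.
  apply: ler_pM => //; last by rewrite /q ler_wpM2r// lerD2r horner_mx_X.
    by rewrite mulr_ge0// addr_ge0 ?l2opnorm_ge0// ltW.
  exact: l2norm_ge0.
have qd0 : q ^+ r * d @[r --> \oo] --> 0.
  rewrite -(mul0r d); apply: cvgMl; apply: cvg_expr.
  by rewrite ger0_norm.
have small e : 0 < e -> \forall r \near \oo, wnorm G (srec r - s) < e.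
  move=> e0; have /cvgrPdist_lt/(_ _ e0) := qd0.
  apply: filterS => r; rewrite sub0r normrN ger0_norm; last first.
    by rewrite mulr_ge0 ?exprn_ge0// ltW.
  exact: le_lt_trans.
split.
- have [c c0 Gc] := l2norm_mulmx_bounded (invmx G).
  apply/cvgrPdist_lt => -[e e'] /=; rewrite ltcE/= => /andP[/eqP-> e0].
  have ec : 0 < e / (c + 1) by rewrite divr_gt0// ltr_wpDl.
  apply: filterS (small _ ec) => r; rewrite ltr_pdivlMr ?ltr_wpDl// => re.
  rewrite distrC (le_lt_trans (mx_norm_le_l2norm _))// ltcR.
  apply: le_lt_trans re; rewrite -{1}(mulKmx Gu (srec r - s)).
  rewrite (le_trans (Gc _))// mulrC ler_wpM2l ?l2norm_ge0//.
  by rewrite lerDl.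
- apply: limn_esup_EFin_le => e e0.
  (* Since [theta], [L ^+ n] and [t] are at most 1, [(theta + 2 t)(L ^+ n + t)] exceeds
     [theta * L ^+ n] by at most [5 t]. *)
  pose t := Num.min 1 (e / 5).
  have t0 : 0 < t by rewrite lt_min ltr01 divr_gt0.
  have t1 : t <= 1 by rewrite ge_min lexx.
  have te : t * 5 <= e by rewrite -ler_pdivlMr// ge_min lexx orbT.
  (* A nearly optimal [g] has a radius depending on [e], but by [small] all late cycles lie within
     it. *)
  have [g [gk g1 gth]] := theta_approx Ft k t0.
  have [d' d'0 Hd'] := cycle_error n df fs Gu FL eta0 t0 gk g1.
  apply: filterS (small _ d'0) => r /ltW rd.
  (* If the limit is hit exactly, division by zero makes the ratio 0. *)
  have [r0|r0] := eqVneq (wnorm G (srec r - s)) 0.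
    by rewrite r0 invr0 mulr0 addr_ge0 ?mulr_ge0// ltW.
  rewrite ler_pdivrMr; last by rewrite lt_def r0 l2norm_ge0.
  have := Hd' _ rd (eps0 r.+1 isT) (epsP r.+1 isT) (epsW r.+1 isT).
  move=> /le_trans; apply; rewrite ler_wpM2r ?l2norm_ge0//.
  apply: (@le_trans _ _ ((theta Ft k + t + t) * (L ^+ n + t))).
    by rewrite ler_wpM2r ?addr_ge0 ?(ltW t0)// lerD2r ltW.
  have h1 : theta Ft k * t <= t by rewrite ler_piMl ?(le_trans thL)// ltW.
  have h2 : t * L ^+ n <= t by rewrite ler_piMr// ltW.
  have h3 : t * t <= t by rewrite ler_piMr// ltW.
  by nra.
- apply: le_lt_trans L1; apply: le_trans thL; exact: ler_piMr.
Qed.
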